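(* Let $k,h$ be positive integers and $\epsilon>0$. Let $n$ be sufficiently large (as a function of $k,h,\epsilon$). Let $\mathcal{F}\subseteq\widetilde{\mathbb{B}}_n$ with $|\mathcal{F}|\geq (k-1+\epsilon)\binom{n}{\lfloor n/2\rfloor}$. For each full chain $M\in\mathcal{C}(\mathbb{B}_n)$ let $Y(M)$ be the set of members of $\mathcal{F}$ contained in $M$. Then there exist functions $X_1,\dots,X_h$ from $\mathcal{C}(\mathbb{B}_n)$ to $2^{\mathcal{F}}$ such that: 1. $X_1(M)=Y(M)$ for all $M\in\mathcal{C}(\mathbb{B}_n)$; 2. for all $1\leq i\leq h-1$ and all $M\in\mathcal{C}(\mathbb{B}_n)$, if $X_{i+1}(M)\neq\emptyset$ then $\frac{|X_{i+1}(M)|}{|X_i(M)|}\geq 1-\frac{1}{4kh}$; 3. for all $i\in[h]$, the set $\mathcal{L}_i=\{(M,Q): M\in\mathcal{C}(\mathbb{B}_n),\ Q\in\binom{X_i(M)}{k}\}$ is a family of $k$-marked chains with markers in $\mathcal{F}$ satisfying $|\mathcal{L}_i|\geq \frac{\epsilon\, n!}{k}\big(1-\frac{i}{2h}\big)$; 4. for all $i\in[h-1]$, every member of $\mathcal{L}_{i+1}$ is good relative to $\mathcal{L}_i$ (with goodness defined with respect to $h$).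
   Context: $\mathbb{B}_n=(2^{[n]},\subseteq)$ with elements called vertices; $\widetilde{\mathbb{B}}_n=\{v\subseteq [n]: |v|\in [\frac n2-2\sqrt{n\ln n},\ \frac n2+2\sqrt{n\ln n}]\}$. $\mathcal{C}(\mathbb{B}_n)$ is the set of the $n!$ full chains of $\mathbb{B}_n$ (chains $[n]=w_n\supset\dots\supset w_0=\emptyset$ with $|w_j|=j$). For a $k$-element subset $Q$ of a chain, $Q$ is written in decreasing order $(F_1,\dots,F_k)$. $D(v)=\{u: u\subseteq v\}$, $U(v)=\{u: v\subseteq u\}$, $D(S)=\bigcup_{w\in S}D(w)$, $U(S)=\bigcup_{w\in S}U(w)$; for $S\subseteq\widetilde{\mathbb{B}}_n$: if $S\cap U(v)=\emptyset$, $D^*(v,S)=[(D(v)\setminus\{v\})\cap(U(S)\cup D(S))]\cap\widetilde{\mathbb{B}}_n$; if $S\cap D(v)=\emptyset$, $U^*(v,S)=[(U(v)\setminus\{v\})\cap(U(S)\cup D(S))]\cap\widetilde{\mathbb{B}}_n$. A $k$-marked chain with markers in $\mathcal{F}$ is a pair $(M,Q)$ with $Q=(F_1,\dots,F_k)$, $F_1\supset\dots\supset F_k$, $F_i\in\mathcal{F}$, $M$ a full chain of $\mathbb{B}_n$ containing all $F_i$ ($F_d$ is the $d$-th member of $Q$). For a family $\mathcal{L}$ of such and $d\in[k]$, $\mathcal{L}(v,d)=\{(M,Q)\in\mathcal{L}: \text{the } d\text{-th member of } Q \text{ is } v\}$. A vertex $v\in\widetilde{\mathbb{B}}_n$ is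 $d$-lower-bad relative to $\mathcal{L}$ if there is $S\subseteq\widetilde{\mathbb{B}}_n$, $S\cap U(v)=\emptyset$, $|S|\leq h$, with $\mathcal{L}(v,d)\neq\emptyset$ and $Q\cap D^*(v,S)\neq\emptyset$ for every $(M,Q)\in\mathcal{L}(v,d)$; it is $d$-upper-bad relative to $\mathcal{L}$ if there is $T\subseteq\widetilde{\mathbb{B}}_n$, $T\cap D(v)=\emptyset$, $|T|\leq h$, with $\mathcal{L}(v,d)\neq\emptyset$ and $Q\cap U^*(v,T)\neq\emptyset$ for every $(M,Q)\in\mathcal{L}(v,d)$. $v$ is $d$-lower-bad (resp. $d$-upper-bad) relative to $M$ and $\mathcal{L}$ if additionally some $Q$ has $(M,Q)\in\mathcal{L}(v,d)$. A $k$-marked chain $(M,Q)$ is good relative to $\mathcal{L}$ if no vertex of $Q$ is $d$-lower-bad or $d$-upper-bad relative to $M$ and $\mathcal{L}$, for any $d\in[k]$. *)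

(* Defs.v *)
From HB Require Import structures.
From mathcomp Require Import all_boot all_order all_algebra.
From mathcomp Require Import reals exp.

Set Implicit Arguments.
Unset Strict Implicit.
Unset Printing Implicit Defensive.

Import Order.TTheory GRing.Theory Num.Theory.

Local Open Scope ring_scope.

Definition middle_layers (R : realType) (n : nat) : {set {set 'I_n}} :=
  [set v : {set 'I_n} |
    n%:R / 2 - 2 * Num.sqrt (n%:R * ln n%:R) <= #|v|%:R :> R
    & #|v|%:R <= n%:R / 2 + 2 * Num.sqrt (n%:R * ln n%:R) :> R].

(* A full chain is represented by the set of its n + 1 members. *)
Definition is_full_chain (n : nat) (M : {set {set 'I_n}}) : bool :=
  [exists w : {ffun 'I_n.+1 -> {set 'I_n}},
    [&& w ord0 == set0, w ord_max == [set: 'I_n],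
        [forall j : 'I_n.+1, #|w j| == j],
        [forall i : 'I_n.+1, forall j : 'I_n.+1, (i < j)%N ==> (w i \proper w j)]
      & M == [set w j | j : 'I_n.+1]]].

Definition full_chains (n : nat) : {set {set {set 'I_n}}} :=
  [set M : {set {set 'I_n}} | is_full_chain M].

Definition downset (n : nat) (v : {set 'I_n}) : {set {set 'I_n}} :=
  [set u : {set 'I_n} | u \subset v].

Definition upset (n : nat) (v : {set 'I_n}) : {set {set 'I_n}} :=
  [set u : {set 'I_n} | v \subset u].

Definition downsets (n : nat) (S : {set {set 'I_n}}) : {set {set 'I_n}} :=
  \bigcup_(w in S) downset w.

Definition upsets (n : nat) (S : {set {set 'I_n}}) : {set {set 'I_n}} :=
  \bigcup_(w in S) upset w.

(* [Dstar] and [Ustar] are total here; the conditions S :&: upset v = set0,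
   respectively S :&: downset v = set0, under which they are meaningful, are
   imposed in [lower_bad] and [upper_bad]. *)
Definition Dstar (R : realType) (n : nat) (v : {set 'I_n})
    (S : {set {set 'I_n}}) : {set {set 'I_n}} :=
  ((downset v :\ v) :&: (upsets S :|: downsets S)) :&: middle_layers R n.

Definition Ustar (R : realType) (n : nat) (v : {set 'I_n})
    (S : {set {set 'I_n}}) : {set {set 'I_n}} :=
  ((upset v :\ v) :&: (upsets S :|: downsets S)) :&: middle_layers R n.

(* Markers are kept as a k-element set Q; this is Q = (F_1, ..., F_k) written
   in decreasing order. *)
Definition decreasing_seq (n : nat) (Q : {set {set 'I_n}}) : seq {set 'I_n} :=
  sort (fun u v : {set 'I_n} => v \subset u) (enum Q).

(* The d-th member F_d of Q; d is counted from 1, so 1 <= d <= #|Q|. *)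
Definition member_at (n : nat) (Q : {set {set 'I_n}}) (d : nat) : {set 'I_n} :=
  nth set0 (decreasing_seq Q) d.-1.

Definition marked_chain (n k : nat) (F : {set {set 'I_n}})
    (MQ : {set {set 'I_n}} * {set {set 'I_n}}) : Prop :=
  [/\ MQ.1 \in full_chains n, #|MQ.2| = k, MQ.2 \subset F & MQ.2 \subset MQ.1].

Definition marked_at (n : nat)
    (L : {set {set {set 'I_n}} * {set {set 'I_n}}}) (v : {set 'I_n}) (d : nat) :
    {set {set {set 'I_n}} * {set {set 'I_n}}} :=
  [set MQ in L | member_at MQ.2 d == v].

Definition lower_bad (R : realType) (n h : nat)
    (L : {set {set {set 'I_n}} * {set {set 'I_n}}}) (d : nat)
    (v : {set 'I_n}) : Prop :=
  v \in middle_layers R n /\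
  exists S : {set {set 'I_n}},
    [/\ S \subset middle_layers R n, S :&: upset v = set0, (#|S| <= h)%N,
        marked_at L v d != set0
      & forall MQ, MQ \in marked_at L v d -> MQ.2 :&: Dstar R v S != set0].

Definition upper_bad (R : realType) (n h : nat)
    (L : {set {set {set 'I_n}} * {set {set 'I_n}}}) (d : nat)
    (v : {set 'I_n}) : Prop :=
  v \in middle_layers R n /\
  exists T : {set {set 'I_n}},
    [/\ T \subset middle_layers R n, T :&: downset v = set0, (#|T| <= h)%N,
        marked_at L v d != set0
      & forall MQ, MQ \in marked_at L v d -> MQ.2 :&: Ustar R v T != set0].

Definition lower_bad_in (R : realType) (n h : nat)
    (L : {set {set {set 'I_n}} * {set {set 'I_n}}}) (M : {set {set 'I_n}})
    (d : nat) (v : {set 'I_n}) : Prop :=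
  lower_bad R h L d v /\
  exists Q : {set {set 'I_n}}, (M, Q) \in marked_at L v d.

Definition upper_bad_in (R : realType) (n h : nat)
    (L : {set {set {set 'I_n}} * {set {set 'I_n}}}) (M : {set {set 'I_n}})
    (d : nat) (v : {set 'I_n}) : Prop :=
  upper_bad R h L d v /\
  exists Q : {set {set 'I_n}}, (M, Q) \in marked_at L v d.

Definition good_marked_chain (R : realType) (n k h : nat)
    (L : {set {set {set 'I_n}} * {set {set 'I_n}}})
    (MQ : {set {set 'I_n}} * {set {set 'I_n}}) : Prop :=
  forall (v : {set 'I_n}) (d : nat), v \in MQ.2 -> (1 <= d <= k)%N ->
    ~ lower_bad_in R h L MQ.1 d v /\ ~ upper_bad_in R h L MQ.1 d v.

Definition k_subsets_family (n k : nat)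
    (X : {set {set 'I_n}} -> {set {set 'I_n}}) :
    {set {set {set 'I_n}} * {set {set 'I_n}}} :=
  [set MQ : {set {set 'I_n}} * {set {set 'I_n}} |
    [&& MQ.1 \in full_chains n, MQ.2 \subset X MQ.1 & #|MQ.2| == k]].

(* Main.v *)
(* Pass from [X_i] to [X_(i+1)] by deleting the set of bad vertices of [M] from
   [X_i(M)], or by emptying it when more than a fraction 1/(4kh) of [X_i(M)] is
   bad. If [v] is bad with witness [S], every chain counted as bad at [v] passes
   through [v] and meets D*(v, S) (or U*(v, S)); since the middle layers have
   width O(sqrt(n ln n)), this is a fraction at most 2 h eta of the chains through
   [v], with [eta] -> 0. So the number of bad pairs (v, M) is at most
   4 k h eta T, where T is the sum of |F & M| over all full chains M.

   The counts |L_i| cannot be controlled directly, as they may concentrate on few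
   long [X_i(M)]. Instead one follows the weight A_i, the sum of |X_i(M)| over the
   M with |X_i(M)| >= k. A step decreases it by at most 4kh times the number of
   bad pairs; A_1 is at least eps n! and at least eps T / (k + eps), so the loss
   is a small fraction of A_1; and A_i <= k |L_i|. *)
Require Import Defs.
From HB Require Import structures.
From mathcomp Require Import all_boot all_order all_fingroup all_algebra.
From mathcomp Require Import zify ring lra.
From mathcomp Require Import boolp reals exp.

Set Implicit Arguments.
Unset Strict Implicit.
Unset Printing Implicit Defensive.

Import Order.TTheory GRing.Theory Num.Theory.

Local Open Scope nat_scope.

(** * Full chains, their symmetries, and counts of chains through a vertex *)

Section FullChains.

Variable n : nat.
Implicit Types (M : {set {set 'I_n}}) (u v w : {set 'I_n}) (s : {perm 'I_n}).

(** The sizes force the endpoints [set0] and [setT] and turn monotonicity into strict inclusion, so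
    this form is easier both to use and to establish. *)
Lemma full_chainP M :
  reflect (exists w : 'I_n.+1 -> {set 'I_n},
             [/\ forall j, #|w j| = j, forall i j : 'I_n.+1, i <= j -> w i \subset w j
               & M = [set w j | j : 'I_n.+1]])
          (M \in full_chains n).
Proof.
rewrite inE; apply: (iffP existsP) => [[w] | [w [cw sw ->]]].
  case/and5P=> _ _ /forallP cw /forallP lw /eqP ->; exists w.
  split=> // [j | i j]; first exact/eqP.
  rewrite leq_eqVlt => /orP[/eqP/val_inj-> // | lt_ij].
  by have /forallP/(_ j)/implyP/(_ lt_ij)/proper_sub := lw i.
exists (finfun w); apply/and5P; split.
- by rewrite ffunE -cards_eq0 cw.
- by rewrite ffunE eqEcard subsetT cardsT card_ord cw leqnn.
- by apply/forallP=> j; rewrite ffunE cw.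
- apply/forallP=> i; apply/forallP=> j; apply/implyP=> lt_ij.
  have le_ij := ltnW lt_ij; by rewrite !ffunE properEcard sw ?cw //= !cw.
- by apply/eqP/eq_imset => j; rewrite ffunE.
Qed.

Lemma full_chain_subset M u v :
  M \in full_chains n -> u \in M -> v \in M -> #|u| <= #|v| -> u \subset v.
Proof.
case/full_chainP=> w [cw sw ->] /imsetP[i _ ->] /imsetP[j _ ->].
by rewrite !cw; apply: sw.
Qed.

Lemma full_chain_inj M u v :
  M \in full_chains n -> u \in M -> v \in M -> #|u| = #|v| -> u = v.
Proof.
move=> fM uM vM cuv; apply/eqP; rewrite eqEsubset.
by rewrite !(full_chain_subset fM) ?cuv.
Qed.

(* The unique member of size [m] when [M] is a full chain and [m <= n]. *)
Definition level M (m : nat) : {set 'I_n} := \bigcup_(u in M | #|u| == m) u.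

Lemma level_card M u : M \in full_chains n -> u \in M -> level M #|u| = u.
Proof.
move=> fM uM; rewrite /level (big_pred1 u) // => v.
apply/andP/eqP => [[vM /eqP/(full_chain_inj fM vM uM)] // | ->].
by rewrite uM.
Qed.

Lemma levelP M m :
  M \in full_chains n -> m <= n -> level M m \in M /\ #|level M m| = m.
Proof.
move=> fM; rewrite -ltnS => lt_mn; have /full_chainP[w [cw _ defM]] := fM.
have wM: w (Ordinal lt_mn) \in M by rewrite defM imset_f.
by have := level_card fM wM; rewrite cw /= => ->; rewrite cw.
Qed.

Lemma full_chain_imset (f : {set 'I_n} -> {set 'I_n}) M :
    (forall u, #|f u| = #|u|) -> {homo f : u v / u \subset v} ->
  M \in full_chains n -> f @: M \in full_chains n.
Proof.
move=> cf sf /full_chainP[w [cw sw ->]]; apply/full_chainP.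
exists (f \o w); rewrite -imset_comp; split=> // [j | i j le_ij] /=.
  by rewrite cf cw.
exact/sf/sw.
Qed.

Lemma full_chain_perm s M :
  M \in full_chains n -> [set s @: u | u : {set 'I_n} in M] \in full_chains n.
Proof.
by apply: full_chain_imset => [u | u v /imsetS//]; apply/card_imset/perm_inj.
Qed.

Lemma full_chain_setC M :
  M \in full_chains n -> [set ~: u | u : {set 'I_n} in M] \in full_chains n.
Proof.
case/full_chainP=> w [cw sw ->]; apply/full_chainP.
exists (fun j => ~: w (rev_ord j)); split=> [j | i j le_ij |].
- have := cardsC (w (rev_ord j)); rewrite card_ord cw /=.
  by have := ltn_ord j; lia.
- by rewrite setCS; apply: sw => /=; lia.
- rewrite -imset_comp; apply/setP=> u; apply/imsetP/imsetP=> -[j _ ->].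
    by exists (rev_ord j); rewrite //= rev_ordK.
  by exists (rev_ord j).
Qed.

(** A permutation sends the initial segments [pre j] to a full chain, and distinct permutations give
    distinct chains. *)
Lemma leq_fact_full_chains : n`! <= #|full_chains n|.
Proof.
pose pre j := [set i : 'I_n | i < j].
pose ch s := [set s @: pre j | j : 'I_n.+1].
have cpre (j : 'I_n.+1): #|pre j| = j.
  have /ltnSE le_jn := ltn_ord j.
  have inj_w : injective (widen_ord le_jn).
    by move=> a b /(congr1 val) /= /val_inj.
  rewrite -[RHS](card_ord j) -(card_imset _ inj_w).
  apply: eq_card => i; rewrite !inE; apply/idP/imsetP=> [lt_ij | [a _ ->]] /=.
    by exists (Ordinal lt_ij) => //; apply: val_inj.
  exact: ltn_ord.
have cpres s (j : 'I_n.+1) : #|s @: pre j| = j.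
  by rewrite card_imset ?cpre //; apply: perm_inj.
have ch_full s : ch s \in full_chains n.
  apply/full_chainP; exists (fun j => s @: pre j); split=> // i j le_ij.
  apply/imsetS/subsetP=> a; rewrite !inE => /leq_trans-> //.
have preE s t (j : 'I_n.+1) : ch s = ch t -> s @: pre j = t @: pre j.
  move=> eq_st; apply: (@full_chain_inj (ch s)); rewrite ?cpres //.
    by rewrite imset_f.
  by rewrite eq_st imset_f.
(* When the chains agree, [s i] lies in [t @: pre i.+1] but not in [t @: pre i], so it is the
   element added there, namely [t i]. *)
have ch_inj : injective ch.
  move=> s t eq_st; apply/permP=> i.
  have lt_in := ltn_ord i; have lt_in1 : i < n.+1 by rewrite ltnW.
  have siP : s i \in t @: pre (inord i.+1 : 'I_n.+1).
    by rewrite -(preE _ _ _ eq_st) imset_f // inE inordK.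
  have /negP siN : s i \notin t @: pre (inord i : 'I_n.+1).
    rewrite -(preE _ _ _ eq_st) mem_imset; last exact: perm_inj.
    by rewrite inE inordK // ltnn.
  case/imsetP: siP => a; rewrite inE inordK // ltnS leq_eqVlt.
  case/orP=> [/eqP/val_inj-> // | lt_ai si_ta].
  by case: siN; rewrite si_ta imset_f // inE inordK.
rewrite -card_Sn -(card_imset _ ch_inj); apply/subset_leq_card/subsetP=> M.
by case/imsetP=> s _ ->.
Qed.

Definition chains_through v := [set M in full_chains n | v \in M].

Lemma leq_chains_through_perm s v :
  #|chains_through v| <= #|chains_through (s @: v)|.
Proof.
have inj_s : injective (fun u : {set 'I_n} => s @: u).
  exact/imset_inj/perm_inj.
rewrite -(card_imset _ (imset_inj inj_s)); apply/subset_leq_card/subsetP=> M'.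
case/imsetP=> M; rewrite in_set => /andP[fM vM] ->.
by rewrite in_set full_chain_perm //= imset_f.
Qed.

(** Exchanging some [x] in [v :\: v'] with some [y] in [v' :\: v] permutes the full chains and
    brings [v] one element closer to [v']. *)
Lemma leq_chains_through v v' :
  #|v| = #|v'| -> #|chains_through v| <= #|chains_through v'|.
Proof.
move En: #|v :\: v'| => m; elim: m v En => [|m IHm] v En cvv'.
  have svv' : v \subset v' by rewrite -setD_eq0 -cards_eq0 En.
  by have /eqP-> : v == v' by rewrite eqEcard svv' cvv' /=.
have [x]: exists x, x \in v :\: v' by apply/card_gt0P; rewrite En.
have [y]: exists y, y \in v' :\: v.
  apply/card_gt0P; have := cardsID v' v; have := cardsID v v'.
  by rewrite setIC En; lia.
rewrite !inE => /andP[yNv yv'] /andP[xNv' xv].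
apply: leq_trans (leq_chains_through_perm (tperm x y) v) _; apply: IHm.
  have -> : tperm x y @: v :\: v' = (v :\: v') :\ x.
    apply/setP=> z; rewrite -[z](tpermK x y) !inE mem_imset;
      last exact: perm_inj.
    rewrite tpermK; case: tpermP => [->|->|/eqP zx /eqP zy].
    - by rewrite (negPf yNv) eqxx andbF.
    - by rewrite yv' andbF.
    - by rewrite zx.
  by have := cardsD1 x (v :\: v'); rewrite !inE xv xNv' En => -[].
by rewrite card_imset //; apply: perm_inj.
Qed.

(** Each full chain meets level [#|v|] in exactly one set, and by symmetry all sets of that level
    carry equally many chains. *)
Lemma card_chains_through v :
  #|chains_through v| * 'C(n, #|v|) = #|full_chains n|.
Proof.
have lvn : #|v| <= n by rewrite -[X in _ <= X]card_ord max_card.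
rewrite -[X in 'C(X, _)]card_ord -card_draws -[RHS]sum1_card.
rewrite [RHS](partition_big (level^~ #|v|)
  [pred u : {set 'I_n} | #|u| == #|v|]); last first.
  by move=> M fM /=; have [_ ->] := levelP fM lvn.
rewrite mulnC -[X in X * _]sum1_card big_distrl /=; apply: eq_big => [u | u].
  by rewrite !inE.
rewrite inE => /eqP cu; rewrite mul1n sum1_card.
transitivity #|chains_through u|.
  by apply/eqP; rewrite eqn_leq !leq_chains_through.
apply: eq_card => M; rewrite [LHS]inE [RHS]inE; apply: andb_id2l => fM.
apply/idP/eqP=> [uM | <-]; first by rewrite -cu level_card.
by have [] := levelP fM lvn.
Qed.

(* By symmetry the count on the left does not depend on [x] in [v], and summed
   over [x] it gives [#|v :\: level M l|] for each chain. *)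
Lemma card_level_notin v x l : x \in v -> l <= #|v| ->
  #|v| * #|[set M in chains_through v | x \notin level M l]|
    = (#|v| - l) * #|chains_through v|.
Proof.
move=> xv le_lv.
have le_ln : l <= n.
  by apply: leq_trans le_lv _; rewrite -[X in _ <= X]card_ord max_card.
pose P x := [set M in chains_through v | x \notin level M l].
have leP y z : y \in v -> z \in v -> #|P y| <= #|P z|.
  move=> yv zv; pose s := tperm y z.
  have inj_s : injective (fun u : {set 'I_n} => s @: u).
    exact/imset_inj/perm_inj.
  have sv : s @: v = v.
    apply/eqP; rewrite eqEcard card_imset ?leqnn ?andbT; last exact: perm_inj.
    by apply/subsetP=> a /imsetP[b bv ->]; rewrite /s; case: tpermP => // ->.
  rewrite -(card_imset _ (imset_inj inj_s)); apply/subset_leq_card/subsetP.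
  move=> M' /imsetP[M]; rewrite in_set => /andP[]; rewrite in_set.
  move=> /andP[fM vM] yM ->; have fsM := full_chain_perm s fM.
  rewrite in_set in_set fsM -{1}sv imset_f //=.
  have [lM cl] := levelP fM le_ln.
  have <- : s @: level M l = level ((fun u => s @: u) @: M) l.
    have cs : #|s @: level M l| = l by rewrite card_imset //; apply: perm_inj.
    by rewrite -[in RHS]cs level_card ?imset_f.
  by rewrite -(tpermL y z) mem_imset //; apply: perm_inj.
have sumP : \sum_(y in v) #|P y| = (#|v| - l) * #|chains_through v|.
  under eq_bigr do rewrite -sum1_card.
  rewrite (exchange_big_dep (mem (chains_through v))) /=; last first.
    by move=> y M _; rewrite inE => /andP[].
  rewrite mulnC -sum_nat_const; apply: eq_bigr => M MC.
  move: (MC); rewrite in_set => /andP[fM vM]; have [lM cl] := levelP fM le_ln.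
  rewrite sum1_card -[in RHS]cl -cardsDS; last first.
    by rewrite (full_chain_subset fM) ?cl.
  by apply: eq_card => y; rewrite in_setD unfold_in /= in_set MC andbC.
rewrite -sumP -sum_nat_const; apply: eq_bigr => y yv.
by apply/eqP; rewrite eqn_leq !leP.
Qed.

End FullChains.

(** * The largest binomial coefficient and the union bound *)

Lemma leq_bin_half n m : 'C(n, m) <= 'C(n, n./2).
Proof.
have incr a b : a <= b -> b <= n./2 -> 'C(n, a) <= 'C(n, b).
  move=> le_ab; rewrite -(subnK le_ab); elim: (b - a) => // c IH.
  rewrite addSn => lt_cn; apply: leq_trans (IH (ltnW lt_cn)) _.
  rewrite -(leq_pmul2l (ltn0Sn (c + a))) mul_bin_left leq_mul2r.
  by apply/orP; right; lia.
have [le_mn | lt_nm] := leqP m n; last by rewrite bin_small.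
have [le_mh | lt_hm] := leqP m n./2; first exact: incr.
by rewrite -bin_sub //; apply: incr; lia.
Qed.

Lemma leq_card_bigcup (I T : finType) (A : {pred I}) (E : I -> {set T}) :
  #|\bigcup_(i in A) E i| <= \sum_(i in A) #|E i|.
Proof.
elim/big_rec2: _ => [|i m X _ le_Xm]; first by rewrite cards0.
by apply: leq_trans (leq_card_setU _ _) _; rewrite leq_add2l.
Qed.

(** * Few chains through a vertex meet [Dstar] or [Ustar] of a small set *)

Section Hitting.

Variables (n W : nat).
Implicit Types (M S : {set {set 'I_n}}) (u v w : {set 'I_n}).

(* Put [m := #|v|] and choose [x] in [v :\: w]. If [u \subset w], then the member
   of size [m - W] of the chain already omits [x]; if [w \subset u], then the
   member of size [m - 1] omits one of the at most [W] elements of [v :\: w]. *)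
Lemma leq_card_hit v w :
    ~~ (v \subset w) -> #|v| <= #|w| + W ->
  #|v| * #|[set M in chains_through v | [exists u in M,
      [&& u \proper v, #|v| <= #|u| + W & (u \subset w) || (w \subset u)]]]|
    <= W.*2 * #|chains_through v|.
Proof.
move=> Nvw le_vw; have /subsetPn[x xv xNw] := Nvw.
pose P y l := [set M in chains_through v | y \notin level M l].
set H := [set M in _ | _].
have v_gt0 : 0 < #|v| by apply/card_gt0P; exists x.
have subH : H \subset P x (#|v| - W) :|:
    \bigcup_(y in [set y in v :\: w | w \subset v]) P y #|v|.-1.
  apply/subsetP=> M; rewrite in_set => /andP[MC /existsP[u]].
  case/and4P=> uM pr_uv le_vu; move: (MC); rewrite in_set => /andP[fM vM].
  have le_vn : #|v| <= n by rewrite -[X in _ <= X]card_ord max_card.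
  case/orP=> [uw | wu]; rewrite in_setU.
    apply/orP; left; rewrite in_set MC /=; apply: contra xNw.
    have [lM cl] := levelP fM (leq_trans (leq_subr W _) le_vn).
    apply/subsetP; apply: subset_trans uw.
    by rewrite (full_chain_subset fM) // cl leq_subLR addnC.
  apply/orP; right; have [lM cl] := levelP fM (leq_trans (leq_pred _) le_vn).
  have sul : u \subset level M #|v|.-1.
    by rewrite (full_chain_subset fM) // cl -ltnS prednK ?proper_card.
  have /subsetPn[y yv yNl] : ~~ (v \subset level M #|v|.-1).
    by apply/negP=> /subset_leq_card; rewrite cl leqNgt ltn_predL v_gt0.
  apply/bigcupP; exists y; last by rewrite in_set MC.
  rewrite inE in_setD yv andbT (subset_trans wu (proper_sub pr_uv)) andbT.
  by apply: contra yNl; apply/subsetP/(subset_trans wu).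
apply: leq_trans (leq_mul (leqnn _) (subset_leq_card subH)) _.
apply: leq_trans (leq_mul (leqnn _) (leq_card_setU _ _)) _.
(* One [W] comes from the gap between [#|v|] and [#|v| - W], the other from the number of elements
   [y] in the union. *)
rewrite mulnDr -addnn mulnDl leq_add //.
  by rewrite card_level_notin ?leq_subr // leq_mul2r; apply/orP; right; lia.
apply: leq_trans (leq_mul (leqnn _) (leq_card_bigcup _ _)) _.
rewrite big_distrr /= (eq_bigr (fun=> #|chains_through v|)) => [|y]; last first.
  rewrite !inE => /andP[/andP[_ yv] _]; rewrite card_level_notin ?leq_pred //.
  by rewrite (_ : #|v| - #|v|.-1 = 1) ?mul1n //; lia.
rewrite sum_nat_const leq_mul2r; apply/orP; right.
(* The index set is empty unless [w \subset v], in which case its size is [#|v| - #|w| <= W]. *)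
have [wv | Nwv] := boolP (w \subset v); last first.
  rewrite (_ : [set y in _ | _] = set0) ?cards0 //.
  by apply/setP=> y; rewrite !inE andbF.
apply: leq_trans (_ : #|v :\: w| <= _); last by rewrite cardsDS //; lia.
by apply/subset_leq_card/subsetP=> y; rewrite inE => /andP[].
Qed.

(** Disjointness from [upset v] says that no [w] in [S] contains [v], so [leq_card_hit] applies to
    each [w]; a union bound over [S] finishes. *)
Lemma leq_card_hit_Dstar (R : realType) v S :
    S \subset middle_layers R n -> S :&: upset v = set0 ->
    (forall u, u \in middle_layers R n -> #|v| <= #|u| + W) ->
  #|v| * #|[set M in chains_through v | M :&: Dstar R v S != set0]|
    <= #|S| * (W.*2 * #|chains_through v|).
Proof.
move=> sSB Sv0 leW.
pose H w := [set M in chains_through v | [exists u in M,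
  [&& u \proper v, #|v| <= #|u| + W & (u \subset w) || (w \subset u)]]].
apply: leq_trans (_ : #|v| * #|\bigcup_(w in S) H w| <= _).
  apply/leq_mul/subset_leq_card/subsetP => // M; rewrite in_set => /andP[MC].
  case/set0Pn=> u /setIP[uM]; rewrite !in_setI in_setD1 in_setU => /andP[].
  case/andP=> /andP[uNv]; rewrite inE => uv uS uB.
  have pr_uv : u \proper v by rewrite properEneq uNv.
  suff [w wS uw] : exists2 w, w \in S & (u \subset w) || (w \subset u).
    apply/bigcupP; exists w; rewrite // in_set MC /=.
    by apply/existsP; exists u; rewrite uM pr_uv uw leW.
  by case/orP: uS => /bigcupP[w wS]; rewrite inE => uw; exists w;
    rewrite ?uw ?orbT.
apply: leq_trans (leq_mul (leqnn _) (leq_card_bigcup _ _)) _.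
rewrite big_distrr -sum_nat_const; apply: leq_sum => w wS.
apply: leq_card_hit; last exact/leW/(subsetP sSB).
by apply/negP=> vw; have /setP/(_ w) := Sv0; rewrite !inE wS vw.
Qed.

Lemma card_setC_ord v : #|~: v| = n - #|v|.
Proof. by rewrite cardsCs setCK card_ord. Qed.

Lemma middle_layers_setC (R : realType) v :
  (~: v \in middle_layers R n) = (v \in middle_layers R n).
Proof.
have le_vn : #|v| <= n by rewrite -[X in _ <= X]card_ord max_card.
rewrite !inE card_setC_ord natrB //.
set r := (n%:R : R)%R; set s := (2 * _)%R; set c := (#|v|%:R)%R.
by apply/andP/andP => -[]; split; lra.
Qed.

Lemma chains_through_setC v :
  #|chains_through (~: v)| = #|chains_through v|.
Proof.
have le_ct u : #|chains_through u| <= #|chains_through (~: u)|.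
  rewrite -(card_imset _ (imset_inj (@setC_inj _))); apply/subset_leq_card.
  apply/subsetP=> _ /imsetP[M + ->]; rewrite in_set => /andP[fM vM].
  by rewrite in_set full_chain_setC //= imset_f.
apply/eqP; rewrite eqn_leq le_ct andbT.
by rewrite -[X in _ <= #|chains_through X|]setCK le_ct.
Qed.

(** Complementation reverses inclusion and preserves full chains and middle layers, so this is the
    bound for [Dstar] at [~: v]; hence the factor [#|~: v|]. *)
Lemma leq_card_hit_Ustar (R : realType) v S :
    S \subset middle_layers R n -> S :&: downset v = set0 ->
    (forall u, u \in middle_layers R n -> #|u| <= #|v| + W) ->
  #|~: v| * #|[set M in chains_through v | M :&: Ustar R v S != set0]|
    <= #|S| * (W.*2 * #|chains_through v|).
Proof.
move=> sSB Sv0 leW; pose co (S : {set {set 'I_n}}) := [set ~: u | u in S].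
have inj_co : injective co by apply/imset_inj/setC_inj.
have memco u S' : (u \in co S') = (~: u \in S').
  by rewrite -[u in LHS]setCK mem_imset //; apply: setC_inj.
have <- : #|co S| = #|S| by rewrite card_imset //; apply: setC_inj.
rewrite -(chains_through_setC v).
have le_card u : #|u| <= n by rewrite -[X in _ <= X]card_ord max_card.
apply: leq_trans (@leq_card_hit_Dstar R (~: v) (co S) _ _ _).
- apply/leq_mul => //; rewrite -(card_imset _ inj_co).
  apply/subset_leq_card/subsetP => _ /imsetP[M + ->].
  rewrite in_set => /andP[]; rewrite in_set => /andP[fM vM] /set0Pn[u].
  case/setIP=> uM; rewrite !in_setI in_setD1 in_setU => /andP[/andP[]].
  case/andP=> uNv; rewrite inE => vu uS uB.
  rewrite 2!in_set full_chain_setC // memco setCK vM; apply/set0Pn.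
  exists (~: u); rewrite !in_setI memco setCK uM in_setD1 inE setCS vu.
  rewrite (inj_eq (@setC_inj _)) uNv middle_layers_setC uB andbT in_setU /=.
  rewrite orbC; case/orP: uS => /bigcupP[w wS]; rewrite inE => uw;
    apply/orP; [left|right]; apply/bigcupP; exists (~: w);
    by rewrite ?memco ?setCK // inE setCS.
- by apply/subsetP=> u; rewrite memco -middle_layers_setC; apply/subsetP.
- apply/setP=> u; rewrite !inE memco; apply/negP=> /andP[uS].
  rewrite -setCS setCK => uv.
  by have /setP/(_ (~: u)) := Sv0; rewrite !inE uS uv.
- move=> u; rewrite -middle_layers_setC => /leW.
  by rewrite !card_setC_ord; have := le_card u; have := le_card v; lia.
Qed.

End Hitting.

(** * The pruning step and its effect on the weight *)

Section Pruning.

Variables (R : realType) (n k h : nat).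
Implicit Types (M Q F : {set {set 'I_n}}) (u v : {set 'I_n}).
Implicit Types (X : {set {set 'I_n}} -> {set {set 'I_n}}).

Lemma sum_card_full_chains X :
  \sum_(M in full_chains n) #|X M|
    = \sum_v #|[set M in full_chains n | v \in X M]|.
Proof.
under eq_bigr do rewrite -sum1_card.
rewrite (exchange_big_dep predT) //=; apply: eq_bigr => v _.
by rewrite sum1_card; apply: eq_card => M; rewrite in_set.
Qed.

Lemma sum_card_inter F :
  \sum_(M in full_chains n) #|F :&: M| = \sum_(v in F) #|chains_through v|.
Proof.
rewrite sum_card_full_chains [RHS]big_mkcond; apply: eq_bigr => v _.
have [vF | vNF] := ifPn.
  by apply: eq_card => M; rewrite !in_set vF.
by apply: eq_card0 => M; rewrite !in_set (negPf vNF) andbF.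
Qed.

(** An inequality of LYM type: the proportion of full chains through [v] is [1 / 'C(n, #|v|)], hence
    at least [1 / 'C(n, n./2)]. *)
Lemma leq_full_chains_sum F :
  #|F| * #|full_chains n| <= 'C(n, n./2) * \sum_(v in F) #|chains_through v|.
Proof.
rewrite -sum_nat_const big_distrr; apply: leq_sum => v _.
by rewrite -(card_chains_through v) mulnC leq_mul2r leq_bin_half orbT.
Qed.

Lemma card_k_subsets_family X :
  #|k_subsets_family k X| = \sum_(M in full_chains n) 'C(#|X M|, k).
Proof.
rewrite -sum1_card.
rewrite (partition_big fst (mem (full_chains n))) => [|MQ]; last first.
  by rewrite in_set => /andP[].
apply: eq_bigr => M fM; have {}fM : M \in full_chains n := fM.
rewrite -cards_draws sum1_card.
have inj_pair : injective (fun Q : {set {set 'I_n}} => (M, Q)).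
  by move=> Q1 Q2 [].
rewrite -[RHS](card_imset _ inj_pair).
apply: eq_card => -[M' Q]; rewrite unfold_in /= in_set /=.
apply/andP/imsetP => [[/and3P[_ sQ cQ] /eqP eM] | [Q']].
  by exists Q; rewrite -?eM // inE sQ.
by rewrite in_set => /andP[sQ cQ] [-> ->]; rewrite fM sQ cQ eqxx.
Qed.

(** Every position [d] counts, whichever marker set realises it, as in [good_marked_chain]; thus all
    [k]-subsets of the remaining vertices are good. *)
Definition bad_members X M : {set {set 'I_n}} :=
  [set v in X M | `[< exists2 d, 1 <= d <= k
     & lower_bad_in R h (k_subsets_family k X) M d v
       \/ upper_bad_in R h (k_subsets_family k X) M d v >]].

(** Emptying is compatible with the required ratio, which concerns nonempty sets only. *)
Definition prune X M : {set {set 'I_n}} :=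
  if 4 * k * h * #|bad_members X M| <= #|X M|
  then X M :\: bad_members X M else set0.

Lemma prune_sub X M : prune X M \subset X M.
Proof. by rewrite /prune; case: ifP; rewrite ?subsetDl ?sub0set. Qed.

Lemma card_prune X M :
  4 * k * h * #|bad_members X M| <= #|X M| ->
  #|prune X M| + #|bad_members X M| = #|X M|.
Proof.
move=> le_bX; rewrite /prune le_bX cardsDS; last by apply/subsetP=> v /setIdP[].
rewrite subnK //; apply/subset_leq_card/subsetP=> v.
by case/setIdP.
Qed.

Lemma good_prune X MQ :
  MQ \in k_subsets_family k (prune X) ->
  good_marked_chain R k h (k_subsets_family k X) MQ.
Proof.
rewrite in_set => /and3P[fM /subsetP sQ _] v d /sQ vP dk.
have vX := subsetP (prune_sub X MQ.1) _ vP.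
move: vP; rewrite /prune; case: ifP => _; last by rewrite in_set0.
rewrite in_setD [v \in bad_members _ _]in_set vX /= => /andP[/asboolPn Nbad _].
by split=> bad_v; apply: Nbad; exists d => //; [left | right].
Qed.

Definition weight X := \sum_(M in full_chains n | k <= #|X M|) #|X M|.

(** Let [b] of the [x] members be bad. An emptied chain loses [x < 4 k h b]. Otherwise the loss is
    [b], or all of [x] when fewer than [k] members survive; then [b > 0] and
    [x < k + b <= 2 k b]. *)
Lemma leq_weight_prune X : 0 < k -> 0 < h ->
  weight X <= weight (prune X)
    + 4 * k * h * \sum_(M in full_chains n) #|bad_members X M|.
Proof.
move=> k_gt0 h_gt0; rewrite /weight !big_mkcondr big_distrr -big_split.
apply: leq_sum => M _ /=.
have [le_bX | lt_Xb] := leqP (4 * k * h * #|bad_members X M|) #|X M|; last first.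
  by case: ifP => // _; apply: leq_trans (leq_addl _ _); apply: ltnW.
have := card_prune le_bX; move: le_bX.
move: #|_| #|prune X M| #|X M| => b y x le_bx eyb.
have [b0 | b_gt0] := posnP b.
  by rewrite b0 muln0 !addn0 in eyb *; rewrite eyb.
have : k * b <= h * (k * b) by rewrite leq_pmull.
have : k <= k * b by rewrite leq_pmulr.
have : b <= k * b by rewrite leq_pmull.
have e : 4 * k * h * b = 4 * (h * (k * b)) by lia.
(* With the products named [p] and [q], all facts are linear: [q <= p], [k <= q] and [b <= q]. *)
rewrite e in le_bx *; move: (h * (k * b)) (k * b) le_bx => p q.
by do 2 case: ifP; lia.
Qed.

(** For [x >= k], [k * 'C(x, k) = x * 'C(x.-1, k.-1) >= x]. *)
Lemma leq_weight_k_subsets X : 0 < k ->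
  weight X <= k * #|k_subsets_family k X|.
Proof.
move=> k_gt0; rewrite card_k_subsets_family big_distrr /weight big_mkcondr.
apply: leq_sum => M _; case: ifP => // le_kX /=.
rewrite -(prednK k_gt0) -mul_bin_diag leq_pmulr // bin_gt0.
by rewrite -ltnS !prednK // (leq_trans k_gt0).
Qed.

(** A chain left out of the weight contributes at most [k.-1]. *)
Lemma leq_sum_weight X :
  \sum_(M in full_chains n) #|X M| <= weight X + k.-1 * #|full_chains n|.
Proof.
rewrite mulnC -sum_nat_const /weight big_mkcondr -big_split; apply: leq_sum => M _ /=.
case: ifP => [_ | /negbT]; first by rewrite leq_addr.
by rewrite -ltnNge add0n; case: k.
Qed.

Local Open Scope ring_scope.

(** * Bounding the bad pairs from the width of the middle layers *)

Section Width.

Variables (W : nat) (eta : R).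
Hypothesis width : forall v : {set 'I_n}, v \in middle_layers R n ->
  [/\ (0 < #|v|)%N, W%:R <= eta * #|v|%:R
    & forall u : {set 'I_n}, u \in middle_layers R n -> (#|v| <= #|u| + W)%N].

(** Turns a hitting bound into a proportion of chains: as [W <= eta * #|v|], the factor [#|v|]
    cancels. *)
Let cancel_size (a b c : nat) (v : {set 'I_n}) : v \in middle_layers R n ->
  (#|v| * a <= b * (W.*2 * c))%N -> (b <= h)%N ->
  a%:R <= 2 * h%:R * eta * c%:R :> R.
Proof.
case/width=> v_gt0 W_le _ le_ab le_bh.
have {}v_gt0 : 0 < #|v|%:R :> R by rewrite ltr0n.
rewrite -(ler_pM2l v_gt0) -[leLHS]natrM.
apply: le_trans (_ : (h * (W.*2 * c))%:R <= _).
  by rewrite ler_nat (leq_trans le_ab) // leq_mul2r le_bh orbT.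
rewrite !natrM -mul2n natrM.
have -> : #|v|%:R * (2 * h%:R * eta * c%:R)
    = h%:R * (2 * (eta * #|v|%:R) * c%:R) by ring.
by do ![rewrite ler_wpM2l ?ler0n // | rewrite ler_wpM2r ?ler0n //].
Qed.

(** For each [v] there are [2 k] ways to be bad, one lower and one upper per position, each covering
    at most a fraction [2 h eta] of the chains through [v]. *)
Lemma ler_sum_bad_members F X :
    F \subset middle_layers R n ->
    (forall M, M \in full_chains n -> X M \subset F :&: M) ->
  (\sum_(M in full_chains n) #|bad_members X M|)%:R
    <= 4 * k%:R * h%:R * eta * (\sum_(v in F) #|chains_through v|)%:R :> R.
Proof.
move=> sFB sX; rewrite sum_card_full_chains natr_sum.
rewrite (bigID (mem F)) /= addrC big1 => [|v vNF]; last first.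
  rewrite eq_card0 // => M; apply/negP; rewrite in_set => /andP[fM].
  rewrite in_set => /andP[vX _].
  by case/negP: vNF; have /subsetP/(_ v vX)/setIP[] := sX M fM.
rewrite add0r natr_sum mulr_sumr; apply: ler_sum => v vF.
have vB := subsetP sFB _ vF.
set L := k_subsets_family k X.
pose lo d := [set M in chains_through v | `[< lower_bad_in R h L M d v >]].
pose up d := [set M in chains_through v | `[< upper_bad_in R h L M d v >]].
have hitP M Q d : (M, Q) \in marked_at L v d -> Q \subset M.
  rewrite in_set => /andP[+ _]; rewrite in_set => /and3P[fM sQ _].
  by apply: subset_trans sQ (subset_trans (sX M fM) (subsetIr _ _)).
have lo_le d : #|lo d|%:R <= 2 * h%:R * eta * #|chains_through v|%:R :> R.
  have [-> | [M0]] := set_0Vmem (lo d).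
    (* Zero counts in [cancel_size] give the nonnegativity of the right-hand side. *)
    by rewrite cards0; apply: (@cancel_size 0 0 _ v); rewrite ?muln0.
  (* [lower_bad] does not depend on the chain, so the witness [S] obtained from [M0] serves every
     chain in [lo d]. *)
  rewrite in_set => /andP[_ /asboolP[[_ [S [sSB Sv0 cS _ hitS]]] _]].
  apply: (cancel_size vB _ cS); have [_ _ leW] := width vB.
  apply: leq_trans (leq_card_hit_Dstar sSB Sv0 leW).
  apply: leq_mul => //; apply/subset_leq_card/subsetP => M.
  rewrite [M \in lo d]in_set => /andP[MC].
  case/asboolP=> _ [Q MQ]; rewrite in_set MC.
  apply: contraNneq (hitS _ MQ) => M0'.
  by rewrite -subset0 -M0' setSI // (hitP _ _ _ MQ).
have up_le d : #|up d|%:R <= 2 * h%:R * eta * #|chains_through v|%:R :> R.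
  have [-> | [M0]] := set_0Vmem (up d).
    by rewrite cards0; apply: (@cancel_size 0 0 _ v); rewrite ?muln0.
  rewrite in_set => /andP[_ /asboolP[[_ [S [sSB Sv0 cS _ hitS]]] _]].
  (* The factor to cancel in the upper case is [#|~: v|]. *)
  have cvB : ~: v \in middle_layers R n by rewrite middle_layers_setC.
  apply: (cancel_size cvB _ cS).
  have leW u : u \in middle_layers R n -> (#|u| <= #|v| + W)%N.
    by case/width=> _ _; apply.
  apply: leq_trans (leq_card_hit_Ustar sSB Sv0 leW).
  apply: leq_mul => //; apply/subset_leq_card/subsetP => M.
  rewrite [M \in up d]in_set => /andP[MC].
  case/asboolP=> _ [Q MQ]; rewrite in_set MC.
  apply: contraNneq (hitS _ MQ) => M0'.
  by rewrite -subset0 -M0' setSI // (hitP _ _ _ MQ).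
(* Positions run from 1 to [k], hence the shift to [d.+1]. *)
apply: le_trans (_ : (\sum_(d < k) (#|lo d.+1| + #|up d.+1|))%:R <= _).
  rewrite ler_nat.
  apply: leq_trans (_ : #|\bigcup_(d < k) (lo d.+1 :|: up d.+1)| <= _)%N.
    apply/subset_leq_card/subsetP=> M; rewrite in_set => /andP[fM].
    rewrite in_set => /andP[vX /asboolP[[//|d] dk bad_v]].
    have /setIP[_ vM] := subsetP (sX M fM) _ vX.
    apply/bigcupP; exists (Ordinal (dk : d < k)%N) => //.
    have MC : M \in chains_through v by rewrite in_set fM.
    apply/setUP; case: bad_v => bad_v; [left | right];
      by rewrite in_set MC; apply/asboolP.
  apply: leq_trans (leq_card_bigcup _ _) _; apply: leq_sum => d _.
  exact: leq_card_setU.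
rewrite natr_sum (_ : 4 * _ * _ * _ * _ =
    \sum_(d < k) (4 * h%:R * eta * #|chains_through v|%:R)); last first.
  by rewrite sumr_const card_ord -mulr_natl; ring.
apply: ler_sum => d _; rewrite natrD.
by have := lo_le d.+1; have := up_le d.+1; lra.
Qed.

End Width.

End Pruning.

(** * Asymptotics: the middle layers are narrow *)

Local Open Scope ring_scope.

(** The layers span [4 s] with [s = sqrt (n ln n)], which is [o(n)], while their lowest size
    [n / 2 - 2 s] is linear in [n]. *)
Lemma middle_layers_width (R : realType) (eta : R) : 0 < eta ->
  exists n0 : nat, forall n, (n0 <= n)%N -> exists W : nat,
  forall v : {set 'I_n}, v \in middle_layers R n ->
    [/\ (0 < #|v|)%N, W%:R <= eta * #|v|%:R
      & forall u : {set 'I_n}, u \in middle_layers R n -> (#|v| <= #|u| + W)%N].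
Proof.
(* [c] solves [4 c = eta (1 / 2 - 2 c)], so [s <= c n] yields [4 s <= eta (n / 2 - 2 s)]. *)
move=> eta_gt0; pose c : R := eta / (8 + 4 * eta).
have den_gt0 : 0 < 8 + 4 * eta by lra.
have c_gt0 : 0 < c by rewrite divr_gt0.
have cE : c * (8 + 4 * eta) = eta by rewrite divfK ?gt_eqF.
have c_lt : c < 1 / 4 by rewrite ltr_pdivrMr //; lra.
have c2_gt0 : 0 < c ^+ 2 by rewrite exprn_gt0.
exists (Num.trunc ((2 / c ^+ 2) ^+ 2)).+1 => n le_n0n.
set s := Num.sqrt (n%:R * ln n%:R : R).
have n_gt0 : 0 < n%:R :> R by rewrite ltr0n; apply: leq_trans le_n0n.
have n_ge : (2 / c ^+ 2) ^+ 2 <= n%:R.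
  by apply/ltW/(lt_le_trans (truncnS_gt _)); rewrite ler_nat.
pose t : R := Num.sqrt n%:R.
have t_gt0 : 0 < t by rewrite sqrtr_gt0.
have tE : t ^+ 2 = n%:R by rewrite sqr_sqrtr // ltW.
have t_ge : 2 <= c ^+ 2 * t.
  rewrite mulrC -ler_pdivrMr // -(ler_pXn2r (n := 2)) ?nnegrE ?tE //.
  - by rewrite divr_ge0 // ltW.
  - exact: ltW.
(* With [t = sqrt n], [ln n = 2 ln t <= 2 t]; then [n ln n <= 2 t n <= c^2 t^2 n = (c n)^2]. *)
have ln_le : ln n%:R <= 2 * t.
  by rewrite -tE lnXn // mulr2n; have := ln_sublinear t_gt0; lra.
have s_ge0 : 0 <= s by rewrite sqrtr_ge0.
have s_le : s <= c * n%:R.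
  have cn_ge0 : 0 <= c * n%:R by rewrite mulr_ge0 ?ltW.
  rewrite -(ger0_norm cn_ge0) -sqrtr_sqr; apply: ler_wsqrtr.
  rewrite exprMn [_ ^+ 2 * _]mulrC expr2 -mulrA ler_pM2l //.
  by apply: le_trans ln_le _; rewrite -tE mulrC [t ^+ 2]expr2 mulrA ler_wpM2r // ltW.
have W_le : 4 * s <= eta * (n%:R / 2 - 2 * s) by nra.
exists (Num.trunc (4 * s)) => v; rewrite inE -/s => /andP[v_ge v_le]; split.
- rewrite -(ltr0n R); apply: lt_le_trans v_ge.
  by rewrite subr_gt0; have := mulr_gt0 (_ : 0 < 1 / 4 - c) n_gt0; lra.
- apply: (@le_trans _ _ (4 * s)); first by rewrite truncn_le; lra.
  by apply: le_trans W_le _; rewrite ler_pM2l.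
- move=> u; rewrite inE -/s => /andP[u_ge u_le].
  rewrite -leq_subLR truncn_ge_nat; last lra.
  have [le_uv | lt_vu] := leqP #|u| #|v|; first by rewrite natrB //; lra.
  (* [leq] unfolds to a truncated difference equal to 0, so [eqP] rewrites [#|v| - #|u|] to 0. *)
  by rewrite (eqP (ltnW lt_vu)); lra.
Qed.

(** * Choice of constants and iteration of the pruning *)

Theorem theorem5p1 (R : realType) (k h : nat) (eps : R)
    (k_gt0 : (0 < k)%N) (h_gt0 : (0 < h)%N) (eps_gt0 : 0 < eps) :
  exists n0 : nat, forall n : nat, (n0 <= n)%N ->
  forall F : {set {set 'I_n}},
    F \subset middle_layers R n ->
    (k%:R - 1 + eps) * 'C(n, n./2)%:R <= #|F|%:R :> R ->
  exists X : nat -> {set {set 'I_n}} -> {set {set 'I_n}},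
    (forall (i : nat) (M : {set {set 'I_n}}),
        (1 <= i <= h)%N -> M \in full_chains n -> X i M \subset F) /\
    [/\ forall M : {set {set 'I_n}}, M \in full_chains n ->
          X 1%N M = F :&: M,
        forall (i : nat) (M : {set {set 'I_n}}),
          (1 <= i <= h - 1)%N -> M \in full_chains n ->
          X i.+1 M != set0 ->
          #|X i.+1 M|%:R / #|X i M|%:R >= 1 - 1 / (4 * k%:R * h%:R) :> R,
        forall i : nat, (1 <= i <= h)%N ->
          (forall MQ, MQ \in k_subsets_family k (X i) ->
             marked_chain k F MQ) /\
          #|k_subsets_family k (X i)|%:R
            >= eps * n`!%:R / k%:R * (1 - i%:R / (2 * h%:R)) :> R
      & forall i : nat, (1 <= i <= h - 1)%N ->
          forall MQ, MQ \in k_subsets_family k (X i.+1) ->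
            good_marked_chain R k h (k_subsets_family k (X i)) MQ].
Proof.
have kR_gt0 : 0 < k%:R :> R by rewrite ltr0n.
have hR_gt0 : 0 < h%:R :> R by rewrite ltr0n.
have keps_gt0 : 0 < k%:R + eps by rewrite addr_gt0.
(* One pruning step costs at most [16 k^2 h^2 eta T], which this choice makes at
   most [A 1 / (2 h)]. *)
pose eta : R := eps / ((k%:R + eps) * (32 * k%:R ^+ 2 * h%:R ^+ 3)).
have eta_gt0 : 0 < eta by rewrite divr_gt0 ?mulr_gt0 ?exprn_gt0.
have [n0 widthP] := middle_layers_width eta_gt0.
exists n0 => n /widthP[W width] F sFB cardF.
(* Indices start at 1: [X 1] is unpruned, and [X i.+1] has undergone [i] prunings. *)
pose X i := iter i.-1 (prune R k h) (fun M => F :&: M).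
have XS i : (0 < i)%N -> X i.+1 = prune R k h (X i) by case: i.
have sX i M : M \in full_chains n -> X i M \subset F :&: M.
  move=> fM; rewrite /X; elim: i.-1 => //= j; apply: subset_trans.
  exact: prune_sub.
pose N : R := #|full_chains n|%:R.
pose T : R := (\sum_(v in F) #|chains_through v|)%:R.
pose A i : R := (weight k (X i))%:R.
have T_ge : (k%:R - 1 + eps) * N <= T.
  have C_gt0 : 0 < 'C(n, n./2)%:R :> R by rewrite ltr0n bin_gt0; lia.
  rewrite -(ler_pM2l C_gt0) mulrA [_ * (_ + eps)]mulrC.
  apply: le_trans (_ : (#|F| * #|full_chains n|)%:R <= _).
    by rewrite natrM ler_wpM2r ?ler0n.
  by rewrite -natrM ler_nat leq_full_chains_sum.
have A1_ge : T <= A 1%N + (k%:R - 1) * N.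
  rewrite (_ : k%:R - 1 = k.-1%:R); last first.
    by rewrite -[in LHS](prednK k_gt0) -natr1 addrK.
  rewrite -natrM -natrD ler_nat.
  by rewrite -sum_card_inter leq_sum_weight.
have N_ge : n`!%:R <= N by rewrite ler_nat leq_fact_full_chains.
have fact_ge0 : 0 <= n`!%:R :> R by rewrite ler0n.
have k_ge1 : 1 <= k%:R :> R by rewrite ler1n.
have A1_geN : eps * N <= A 1%N by lra.
(* Multiply [A1_ge] by [eps] and bound [eps * N] by [A 1]. *)
have A1_geT : eps * T <= (k%:R + eps) * A 1%N by nra.
have loss i : (0 < i)%N -> A i <= A i.+1 + A 1%N / (2 * h%:R).
  move=> i_gt0; rewrite /A XS //.
  have := leq_weight_prune R (X i) k_gt0 h_gt0; rewrite -(ler_nat R) natrD.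
  move/le_trans; apply; rewrite lerD2l !natrM.
  have /(ler_wpM2l (_ : 0 <= 4 * k%:R * h%:R)) :=
    ler_sum_bad_members k h width sFB (sX i).
  rewrite -/T => /(_ _)/le_trans->//; first by rewrite !mulr_ge0 ?ler0n.
  rewrite ler_pdivlMr ?mulr_gt0 //.
  have -> : 4 * k%:R * h%:R * (4 * k%:R * h%:R * eta * T) * (2 * h%:R)
            = eps * T / (k%:R + eps).
    by rewrite /eta; field; rewrite !gt_eqF.
  by rewrite ler_pdivrMr // [leRHS]mulrC.
have A_ge i : A 1%N * (1 - i%:R / (2 * h%:R)) <= A i.+1.
  elim: i => [|i IHi]; first by rewrite mul0r subr0 mulr1.
  have := loss i.+1 isT; rewrite -(natr1 i); move: IHi.
  by move: (_^-1) => d; lra.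
exists X; split=> [i M _ fM|].
  exact: subset_trans (sX i M fM) (subsetIl _ _).
split=> //.
- move=> [//|i] M _ fM; rewrite XS // => X_neq0.
  (* A nonempty result rules out the emptying branch, and the test of [prune] is then the required
     ratio. *)
  have le_bX : (4 * k * h * #|bad_members R k h (X i.+1) M| <= #|X i.+1 M|)%N.
    by move: X_neq0; rewrite /prune; case: ifP; rewrite ?eqxx.
  have cX := card_prune le_bX.
  have X_gt0 : 0 < #|X i.+1 M|%:R :> R.
    rewrite ltr0n; apply: leq_trans (subset_leq_card (prune_sub R k h _ _)).
    by rewrite card_gt0.
  have c_gt0 : 0 < 4 * k%:R * h%:R :> R by rewrite !mulr_gt0.
  rewrite ler_pdivlMr // mulrBl !mul1r lerBlDr.
  rewrite -{1}cX natrD lerD2l mulrC ler_pdivlMr // mulrC.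
  by rewrite -!natrM ler_nat.
- move=> [//|i] /andP[_ le_ih]; split.
    move=> MQ; rewrite in_set => /and3P[fM sQ /eqP cQ].
    have /subsetIP[sF sM] := subset_trans sQ (sX i.+1 _ fM).
    by split.
  have := leq_weight_k_subsets (X i.+1) k_gt0; rewrite -(ler_nat R) natrM -/(A _).
  (* [A_ge] has [i] where the goal has [i.+1]: one step of slack, given up here. *)
  have := A_ge i; have i_le : i%:R / (2 * h%:R) <= i.+1%:R / (2 * h%:R) :> R.
    by rewrite ler_pM2r ?invr_gt0 ?mulr_gt0 // ler_nat.
  move: i_le; set p := i%:R / _; set q := i.+1%:R / _ => le_pq ge_p ge_k.
  have q_le1 : q <= 1.
    have le_ihR : i.+1%:R <= h%:R :> R by rewrite ler_nat.
    rewrite /q ler_pdivrMr ?mulr_gt0 // mul1r (le_trans le_ihR) //.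
    by rewrite ler_peMl ?ltW // ltr1n.
  rewrite mulrAC ler_pdivrMr // [leRHS]mulrC.
  apply: le_trans ge_k; apply: le_trans ge_p.
  apply: le_trans (_ : A 1%N * (1 - q) <= _).
    rewrite ler_wpM2r ?subr_ge0 //; apply: le_trans A1_geN.
    by rewrite ler_wpM2l // ltW.
  have A1_ge0 : 0 <= A 1%N by rewrite /A ler0n.
  by rewrite ler_wpM2l // lerB.
- by move=> [//|i] _ MQ; rewrite XS //; apply: good_prune.
Qed.
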